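(* Let $n\ge 1$. For all $\Phi_{1},\Phi_{2}\in\mathring{\mathcal{S}}_{+,\mathrm{rat}}^{n\times n}(\mathbb{T})$ and all $\tau\in\mathbb{R}$, one has $\chi_{T}(\tau)\in\mathring{\mathcal{S}}_{+,\mathrm{rat}}^{n\times n}(\mathbb{T})$, where $$\chi_{T}(\tau):=\begin{cases} \left(\dfrac{\beta^{\tau}-\alpha^{\tau}}{\beta-\alpha}\right)\Phi_{2}+\left(\dfrac{\beta\alpha^{\tau}-\alpha\beta^{\tau}}{\beta-\alpha}\right)\Phi_{1}, & \text{if } \beta\neq \alpha,\\[2mm] \alpha^{\tau}\Phi_{1}, & \text{if } \beta= \alpha, \end{cases}$$ with $$\beta:=\left\|W_{1}^{-1}W_{2}\right\|^{2}_{\mathcal{H}_{\infty}},\qquad \alpha:=\frac{1}{\left\|W_{2}^{-1}W_{1}\right\|^{2}_{\mathcal{H}_{\infty}}},$$ and $W_{1},W_{2}\in\mathbb{R}^{n\times n}(z)$ the minimum-phase spectral factors of $\Phi_{1}$ and $\Phi_{2}$, respectively.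
   Context: $\mathbb{T}$ is the unit circle and $\mathbb{D}$ the open unit disk in the complex plane. $\mathbb{R}^{n\times m}(z)$ is the set of $n\times m$ matrices of rational functions of $z$ with real coefficients. For $A(z)\in\mathbb{R}^{n\times m}(z)$, $A^{*}(z):=A^{\top}(1/z)$ (on $\mathbb{T}$ this is the Hermitian transpose). Let $\mathcal{L}_2^n[-\pi,\pi]$ be the Hilbert space of square integrable $\mathbb{C}^n$-valued functions on $\mathbb{T}$ with $\langle f,g\rangle_2=\int_{-\pi}^{\pi} f(e^{j\theta})^*g(e^{j\theta})\frac{d\theta}{2\pi}$, where $j$ is the imaginary unit. Spectral densities: $\mathcal{S}_{+}^{n\times n}(\mathbb{T})$ is the cone of bounded functions $\Phi:\mathbb{T}\to\mathbb{C}^{n\times n}$ with $\Phi(e^{j\theta})=\Phi(e^{j\theta})^*$ for all $\theta$ and $\langle f,\Phi f\rangle_2\ge 0$ for all $f\in\mathcal{L}_2^n[-\pi,\pi]$. $\mathcal{S}_{+,\mathrm{rat}}^{n\times n}(\mathbb{T})$ is the subset of those $\Phi$ that are real rational, i.e. restrictions to $\mathbb{T}$ of elements of $\mathbb{R}^{n\times n}(z)$ (bounded on $\mathbb{T}$). $\mathring{\mathcal{S}}_{+,\mathrm{rat}}^{n\times n}(\mathbb{T})$ denotes the set of elements of $\mathcal{S}_{+,\mathrm{rat}}^{n\times n}(\mathbb{T})$ lying in the interior of the cone, i.e. those $\Phi\in\mathcal{S}_{+,\mathrm{rat}}^{n\times n}(\mathbb{T})$ such that $\Phi(e^{j\theta})$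 is positive definite for all $\theta\in[-\pi,\pi]$. Minimum-phase spectral factor: a rational $W(z)\in\mathbb{R}^{n\times n}(z)$ is a spectral factor of $\Phi$ if $\Phi(z)=W(z)W^{*}(z)$. It is minimum-phase if it is analytic in an open set containing the complement of $\mathbb{D}$ and its inverse is analytic in the complement of the closure of $\mathbb{D}$; complements are taken in the extended complex plane $\mathbb{C}\cup\{\infty\}$. For a real rational spectral density that is invertible almost everywhere on $\mathbb{T}$, a minimum-phase spectral factor exists and is unique up to right multiplication by a real orthogonal $n\times n$ matrix. $\mathcal{H}_\infty$-norm: $\|G\|_{\mathcal{H}_\infty}:=\sup_{z\in\mathbb{C},\,|z|>1}\sigma_{\max}(G(z))$, where $\sigma_{\max}$ is the largest singular value. *)

(* Defs.v *)
From HB Require Import structures.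
From mathcomp Require Import all_boot all_order all_algebra.
From mathcomp Require Import all_classical all_reals all_analysis.
From mathcomp Require Import fraction complex.

Set Implicit Arguments.
Unset Strict Implicit.
Unset Printing Implicit Defensive.

Import Order.TTheory GRing.Theory Num.Theory.
Import numFieldNormedType.Exports.

Local Open Scope classical_set_scope.
Local Open Scope ring_scope.
Local Open Scope complex_scope.
Local Open Scope sesquilinear_scope.

(* R(z), the field of real rational functions *)
Notation ratfun R := {fraction {poly R}}.

(* the extended complex plane; its point at infinity is [None] *)
Notation sphere R := (one_point_compactification (R[i]^o)).

Section RationalFunctions.
Variable R : realType.

(* A fraction is evaluated in lowest terms, so that a zero of the denominator
   is a genuine pole. *)
Definition rnum (f : ratfun R) : {poly R} :=
  let x := frac (repr f) in x.1 %/ gcdp x.1 x.2.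
Definition rden (f : ratfun R) : {poly R} :=
  let x := frac (repr f) in x.2 %/ gcdp x.1 x.2.

Definition no_pole (f : ratfun R) (z : R[i]) : bool :=
  ~~ root (map_poly (real_complex R) (rden f)) z.

(* The value is only meaningful when [no_pole f z]. *)
Definition reval (f : ratfun R) (z : R[i]) : R[i] :=
  (map_poly (real_complex R) (rnum f)).[z] /
  (map_poly (real_complex R) (rden f)).[z].

(* f(1/z), as a rational function of z *)
Definition recip (f : ratfun R) : ratfun R :=
  let x : ratfun R := (tofrac 'X)^-1 in
  (map_poly (@tofrac {poly R} \o polyC) (rnum f)).[x] /
  (map_poly (@tofrac {poly R} \o polyC) (rden f)).[x].

Definition mx_reval m n (F : 'M[ratfun R]_(m, n)) (z : R[i]) :
    'M[R[i]]_(m, n) :=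
  map_mx (fun f => reval f z) F.

(* A^*(z) = A^T(1/z) *)
Definition para m n (A : 'M[ratfun R]_(m, n)) :
    'M[ratfun R]_(n, m) :=
  (map_mx recip A)^T.

Definition holo_at (f : ratfun R) (z : R[i]) : Prop :=
  no_pole f z /\ derivable (reval f : R[i]^o -> R[i]^o) (z : R[i]^o) 1.

(* Analyticity at infinity is analyticity of w |-> f(1/w) at w = 0. *)
Definition analytic_at (f : ratfun R) (p : sphere R) : Prop :=
  if p is Some z then holo_at f z else holo_at (recip f) 0.

Definition mx_analytic_on m n (A : set (sphere R))
    (F : 'M[ratfun R]_(m, n)) : Prop :=
  forall p, A p -> forall i k, analytic_at (F i k) p.

End RationalFunctions.

Section SpectralDensities.
Variable R : realType.

Definition circle : Type := {z : R[i] | `|z| == 1}.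

Lemma cis_subproof (t : R) : `|cos t +i* sin t| == 1.
Proof. by rewrite normc_def cos2Dsin2 sqrtr1. Qed.

(* e^{j t} *)
Definition cis (t : R) : circle := exist _ (cos t +i* sin t) (cis_subproof t).

Definition circle_measurable (h : circle -> R[i]) : Prop :=
  measurable_fun `[- pi, pi] (fun t => complex.Re (h (cis t))) /\
  measurable_fun `[- pi, pi] (fun t => complex.Im (h (cis t))).

(* \int_{-pi}^{pi} h(e^{jt}) dt / (2 pi), for complex-valued h *)
Definition circle_integral (h : circle -> R[i]) : R[i] :=
  let I (g : R -> R) := \int[lebesgue_measure]_(t in `[- pi, pi]) g t in
  (I (fun t => complex.Re (h (cis t))) / (2 * pi)) +i*
  (I (fun t => complex.Im (h (cis t))) / (2 * pi)).

Definition L2 n (f : circle -> 'cV[R[i]]_n) : Prop :=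
  forall i, circle_measurable (fun z => f z i 0) /\
    lebesgue_measure.-integrable `[- pi, pi]
      (fun t => (complex.Re (f (cis t) i 0) ^+ 2
               + complex.Im (f (cis t) i 0) ^+ 2)%:E).

Definition inner n (f g : circle -> 'cV[R[i]]_n) : R[i] :=
  circle_integral (fun z => ((f z)^t* *m g z) 0 0).

(* Measurability, implicit in the mathematical definition, is what gives a
   meaning to <f, Phi f>; it is automatic for rational Phi. *)
Definition spectral_density n (Phi : circle -> 'M[R[i]]_n) : Prop :=
  [/\ exists M : R, forall z i k, `|Phi z i k| <= M%:C,
      forall i k, circle_measurable (fun z => Phi z i k),
      forall z, Phi z = (Phi z)^t* &
      forall f, L2 f -> 0 <= inner f (fun z => Phi z *m f z)].

Definition restricts_to n (F : 'M[ratfun R]_n)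
    (Phi : circle -> 'M[R[i]]_n) : Prop :=
  forall z : circle, (forall i k, no_pole (F i k) (sval z)) /\
    Phi z = mx_reval F (sval z).

Definition rat_spectral_density n (Phi : circle -> 'M[R[i]]_n) : Prop :=
  spectral_density Phi /\
  exists F : 'M[ratfun R]_n, restricts_to F Phi.

Definition posdefmx n (A : 'M[R[i]]_n) : Prop :=
  A = A^t* /\ forall x : 'cV[R[i]]_n, x != 0 -> 0 < (x^t* *m A *m x) 0 0.

(* the interior part of the cone of rational spectral densities *)
Definition pd_rat_spectral_density n (Phi : circle -> 'M[R[i]]_n) : Prop :=
  rat_spectral_density Phi /\ forall z, posdefmx (Phi z).

End SpectralDensities.

Section Factors.
Variable R : realType.

(* A rational function is determined by its restriction to the circle, so this
   is the identity Phi(z) = W(z) W^*(z) of rational matrices. *)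
Definition spectral_factor n (W : 'M[ratfun R]_n)
    (Phi : circle R -> 'M[R[i]]_n) : Prop :=
  restricts_to (W *m para W) Phi.

Definition unit_disk : set (R[i]^o) := [set z | `|z : R[i]| < 1].

Definition exterior_closed : set (sphere R) := ~` (Some @` unit_disk).
Definition exterior_open : set (sphere R) := ~` (Some @` closure unit_disk).

Definition minimum_phase n (W : 'M[ratfun R]_n) : Prop :=
  [/\ exists U : set (sphere R),
        [/\ open U, exterior_closed `<=` U & mx_analytic_on U W],
      W \in unitmx &
      mx_analytic_on exterior_open (invmx W)].

Definition min_phase_factor n (W : 'M[ratfun R]_n)
    (Phi : circle R -> 'M[R[i]]_n) : Prop :=
  spectral_factor W Phi /\ minimum_phase W.

Definition singular_value m n (A : 'M[R[i]]_(m, n)) : set R :=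
  [set s | 0 <= s /\ eigenvalue (A^t* *m A) ((s ^+ 2)%:C)].

(* The set of singular values is finite, and nonempty for n > 0. *)
Definition sigma_max m n (A : 'M[R[i]]_(m, n)) : R := sup (singular_value A).

(* [sup] is the least upper bound of nonempty bounded sets only; the norm is
   applied to products W1^-1 W2 of minimum-phase factors, which are bounded on
   |z| > 1 when the densities are positive definite on the circle. *)
Definition Hinfty_norm n (G : 'M[ratfun R]_n) : R :=
  sup [set sigma_max (mx_reval G z) | z in [set z : R[i] | 1 < `|z|]].

Definition beta n (W1 W2 : 'M[ratfun R]_n) : R :=
  Hinfty_norm (invmx W1 *m W2) ^+ 2.

Definition alpha n (W1 W2 : 'M[ratfun R]_n) : R :=
  1 / Hinfty_norm (invmx W2 *m W1) ^+ 2.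

Definition chi_T n (Phi1 Phi2 : circle R -> 'M[R[i]]_n) (a b tau : R) :
    circle R -> 'M[R[i]]_n :=
  fun z =>
    if b != a then
      ((b `^ tau - a `^ tau) / (b - a))%:C *: Phi2 z +
      ((b * a `^ tau - a * b `^ tau) / (b - a))%:C *: Phi1 z
    else (a `^ tau)%:C *: Phi1 z.

End Factors.

(* Main.v *)
Require Import Defs.
From HB Require Import structures.
From mathcomp Require Import all_boot all_order all_algebra.
From mathcomp Require Import all_classical all_reals all_analysis.
From mathcomp Require Import measurable_realfun generic_quotient fraction complex.
From mathcomp Require Import ring lra.

Set Implicit Arguments.
Unset Strict Implicit.
Unset Printing Implicit Defensive.

Import Order.TTheory GRing.Theory Num.Theory.
Import numFieldNormedType.Exports.

Local Open Scope classical_set_scope.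
Local Open Scope ring_scope.
Local Open Scope complex_scope.
Local Open Scope sesquilinear_scope.

(** On the circle alpha Phi1 <= Phi2 <= beta Phi1 with 0 < alpha <= beta, and
    for beta <> alpha

      chi(tau) = (beta^tau (Phi2 - alpha Phi1) + alpha^tau (beta Phi1 - Phi2))
                 / (beta - alpha)

    is a combination, with positive weights, of two nonnegative forms whose sum
    (beta - alpha) Phi1 is positive definite; hence chi(tau) is positive
    definite.  When beta = alpha it is alpha^tau Phi1.  Real coefficients keep
    chi(tau) rational, and pointwise positivity makes <f, chi f> nonnegative.

    The comparison Phi2 <= beta Phi1 ([density_le]) comes from G = W1^-1 W2.
    Where |z| > 1, the spectral theorem for G^* G gives
    |G(z) x|^2 <= beta |x|^2 ([sqnorm_le_sigma_max]).  The adjoint of G(z) obeys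
    the same bound, and W2^* = G^* W1^*, so
    |W2(z)^* x|^2 <= beta |W1(z)^* x|^2; both sides are continuous up to the
    circle, where they are the quadratic forms of Phi2 and beta Phi1.
    Exchanging the two factors gives alpha Phi1 <= Phi2.

    All this needs the norms of W1^-1 W2 and W2^-1 W1 to be suprema of bounded
    sets ([ratio_bounded]).  The entries of a minimum-phase factor have no pole
    on |z| >= 1 or at infinity; on the circle W W^* is positive definite, so W is
    invertible there and, by Cramer's rule, the inverse has no pole on |z| >= 1
    either.  A rational function with no pole there or at infinity is bounded:
    after z |-> 1/z this is the statement for the closed disk, and there the
    denominator is a product of factors bounded below. *)

(** * Evaluation of rational functions and matrices *)

Section Evaluation.
Variable R : realType.
Implicit Types (f g : ratfun R) (p q : {poly R}) (z : R[i]).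

Local Notation peval p z := (map_poly (real_complex R) p).[z].

Lemma numden_ratfun f : tofrac (frac (repr f)).1 / tofrac (frac (repr f)).2 = f.
Proof.
set x := repr f.
have x2 : tofrac (frac x).2 != 0 :> ratfun R by rewrite tofrac_eq0 denom_ratioP.
apply: (mulIf x2); rewrite divfK //.
rewrite -[X in _ = X * _]reprK -/x !piE; apply/eqmodP; rewrite /= FracField.equivfE /FracField.mulf.
by rewrite !numden_Ratio ?mulf_neq0 ?oner_neq0 ?denom_ratioP // !mulr1 mul1r.
Qed.

Lemma rden_neq0 f : rden f != 0.
Proof.
by rewrite /rden dvdp_div_eq0 ?dvdp_gcdr ?denom_ratioP.
Qed.

Lemma coprimep_rnum_rden f : coprimep (rnum f) (rden f).
Proof. by rewrite coprimep_div_gcd // denom_ratioP orbT. Qed.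

Lemma ratfunE f : f = tofrac (rnum f) / tofrac (rden f).
Proof.
rewrite -[LHS]numden_ratfun /=; set x := frac _.
have g0 : gcdp x.1 x.2 != 0 by rewrite gcdp_eq0 negb_and denom_ratioP orbT.
rewrite -(divpK (dvdp_gcdl x.1 x.2)) -{3}(divpK (dvdp_gcdr x.1 x.2)).
by rewrite !rmorphM /= -mulf_div divff ?mulr1 // tofrac_eq0.
Qed.

(** Evaluation is a relation because a rational function has a value only off
    its poles; as such it is closed under the field operations. *)
Definition evals f z (c : R[i]) : Prop := no_pole f z /\ reval f z = c.

(** Evaluation may use any fraction whose denominator does not vanish at z,
    not only the reduced one: a zero of the reduced denominator would be a
    zero of the reduced numerator too, against coprimality. *)
Lemma evals_frac p q z : peval q z != 0 ->
  evals (tofrac p / tofrac q) z (peval p z / peval q z).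
Proof.
move=> qz; have q0 : q != 0.
  by apply: contraNneq qz => ->; rewrite rmorph0 horner0.
set f := tofrac p / tofrac q.
have d0 := rden_neq0 f.
have /(congr1 (fun r => peval r z)) : p * rden f = rnum f * q.
  apply/eqP; rewrite -tofrac_eq !rmorphM /= -eqr_div ?tofrac_eq0 //.
  by rewrite -/f -ratfunE.
rewrite !rmorphM !hornerM /= => E.
have dz : peval (rden f) z != 0.
  apply: contraTneq (coprimep_rnum_rden f) => dz.
  move: E; rewrite dz mulr0 => /esym/eqP; rewrite mulf_eq0 (negPf qz) orbF.
  move=> nz; rewrite -(coprimep_map (real_complex R)).
  apply/negP => /coprimep_root /(_ nz); by rewrite dz eqxx.
split; first by rewrite /no_pole rootE.
by apply/eqP; rewrite /reval eqr_div // -E.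
Qed.

Lemma evals_split f z c : evals f z c -> exists p q,
  [/\ f = tofrac p / tofrac q, peval q z != 0 & c = peval p z / peval q z].
Proof.
by case=> fz <-; exists (rnum f), (rden f); split=> //; exact: ratfunE.
Qed.

Lemma evals_poly p z : evals (tofrac p) z (peval p z).
Proof.
have p1 : peval 1 z = 1 by rewrite rmorph1 hornerC.
by have := @evals_frac p 1 z; rewrite p1 oner_neq0 rmorph1 !divr1; exact.
Qed.

Lemma evalsD f g z a b : evals f z a -> evals g z b -> evals (f + g) z (a + b).
Proof.
move=> /evals_split[p1 [q1 [-> fz ->]]] /evals_split[p2 [q2 [-> gz ->]]].
have q0 q : peval q z != 0 -> tofrac q != 0 :> ratfun R.
  by apply: contraNneq => /eqP; rewrite tofrac_eq0 => /eqP->; rewrite rmorph0 horner0.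
have := @evals_frac (p1 * q2 + p2 * q1) (q1 * q2) z.
rewrite !(rmorphD, rmorphM, hornerD, hornerM) /= -!addf_div ?q0 //; apply.
exact: mulf_neq0.
Qed.

Lemma evalsM f g z a b : evals f z a -> evals g z b -> evals (f * g) z (a * b).
Proof.
move=> /evals_split[p1 [q1 [-> fz ->]]] /evals_split[p2 [q2 [-> gz ->]]].
have := @evals_frac (p1 * p2) (q1 * q2) z.
rewrite !(rmorphM, hornerM) /= -!mulf_div; apply.
exact: mulf_neq0.
Qed.

Lemma evalsV f z a : evals f z a -> a != 0 -> evals f^-1 z a^-1.
Proof.
move=> /evals_split[p [q [-> fz ->]]] a0; rewrite !invf_div.
by apply: evals_frac; apply: contraNneq a0 => ->; rewrite mul0r.
Qed.

Lemma evals0 z : evals 0 z 0.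
Proof. by have := evals_poly 0 z; rewrite !rmorph0 horner0. Qed.

Lemma evals1 z : evals 1 z 1.
Proof. by have := evals_poly 1 z; rewrite !rmorph1 hornerC. Qed.

Lemma evalsC (c : R) z : evals (tofrac c%:P) z c%:C.
Proof. by have := evals_poly c%:P z; rewrite map_polyC hornerC. Qed.

Lemma evals_sum (I : Type) (r : seq I) (P : pred I) (F : I -> ratfun R) G z :
  (forall i, P i -> evals (F i) z (G i)) ->
  evals (\sum_(i <- r | P i) F i) z (\sum_(i <- r | P i) G i).
Proof.
move=> FG; elim/big_ind2: _ => //; first exact: evals0.
by move=> *; exact: evalsD.
Qed.

Lemma evals_prod (I : Type) (r : seq I) (P : pred I) (F : I -> ratfun R) G z :
  (forall i, P i -> evals (F i) z (G i)) ->
  evals (\prod_(i <- r | P i) F i) z (\prod_(i <- r | P i) G i).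
Proof.
move=> FG; elim/big_ind2: _ => //; first exact: evals1.
by move=> *; exact: evalsM.
Qed.

Lemma evals_sign k f z a :
  evals f z a -> evals ((-1) ^+ k * f) z ((-1) ^+ k * a).
Proof.
move=> fz; apply: evalsM => //.
have -> : (-1) ^+ k = tofrac ((-1) ^+ k : R)%:P :> ratfun R.
  by rewrite !rmorphXn !rmorphN !rmorph1.
by have := evalsC ((-1) ^+ k) z; rewrite !rmorphXn !rmorphN !rmorph1.
Qed.

(** The numerator and the denominator of [recip f] are values of polynomials at
    the rational function 1/z, and such values evaluate as expected. *)
Lemma evals_recip f z : z != 0 -> no_pole f z^-1 ->
  evals (recip f) z (reval f z^-1).
Proof.
move=> z0 fz; have xz : evals (tofrac 'X)^-1 z z^-1.
  by apply: evalsV => //; have := evals_poly 'X z; rewrite map_polyX hornerX.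
have H p : evals (map_poly (@tofrac {poly R} \o polyC) p).[(tofrac 'X)^-1] z
                 (peval p z^-1).
  elim/poly_ind: p => [|p c IH]; first by rewrite !rmorph0 !horner0; exact: evals0.
  rewrite !rmorphD !rmorphM /= !map_polyX !map_polyC !hornerE /=.
  by apply: evalsD; [exact: evalsM | exact: evalsC].
rewrite /recip /reval; apply: evalsM => //; apply: evalsV => //.
Qed.

Lemma horner_real_conj p z : peval p z^*%C = (peval p z)^*%C.
Proof.
rewrite -horner_map /= -map_poly_comp /=; congr _.[_].
by apply: eq_map_poly => x /=; rewrite oppr0.
Qed.

Lemma reval_conj f z : reval f z^*%C = (reval f z)^*%C.
Proof. by rewrite /reval !horner_real_conj rmorphM /= fmorphV. Qed.

Lemma no_pole_conj f z : no_pole f z^*%C = no_pole f z.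
Proof. by rewrite /no_pole !rootE horner_real_conj conjc_eq0. Qed.

Definition mx_evals m n (F : 'M[ratfun R]_(m, n)) z (A : 'M[R[i]]_(m, n)) :=
  forall i k, evals (F i k) z (A i k).

Lemma mx_evalsP m n (F : 'M[ratfun R]_(m, n)) z (A : 'M[R[i]]_(m, n)) :
  mx_evals F z A <-> (forall i k, no_pole (F i k) z) /\ mx_reval F z = A.
Proof.
split=> [FA|[Fz <-] i k]; last by split; rewrite ?mxE.
split=> [i k|]; first by case: (FA i k).
by apply/matrixP => i k; rewrite mxE; case: (FA i k).
Qed.

Lemma mx_evalsM m n l (F : 'M[ratfun R]_(m, n)) (G : 'M[ratfun R]_(n, l)) z A B :
  mx_evals F z A -> mx_evals G z B -> mx_evals (F *m G) z (A *m B).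
Proof.
by move=> FA GB i k; rewrite !mxE; apply: evals_sum => j _; apply: evalsM.
Qed.

Lemma evals_det n (F : 'M[ratfun R]_n) z A :
  mx_evals F z A -> evals (\det F) z (\det A).
Proof.
move=> FA; apply: evals_sum => s _; apply: evals_sign.
by apply: evals_prod => i _; exact: FA.
Qed.

(** Cramer's rule: inversion creates poles only where the determinant
    vanishes. *)
Lemma mx_evals_inv n (F : 'M[ratfun R]_n) z A : mx_evals F z A ->
  A \in unitmx -> mx_evals (invmx F) z (invmx A).
Proof.
move=> FA Au; have dF := evals_det FA.
have dA : \det A != 0 by rewrite -unitfE.
have Fu : F \in unitmx.
  rewrite unitmxE unitfE; apply: contraNneq dA => F0.
  by move: dF; rewrite F0 => -[_ <-]; case: (evals0 z) => _ ->.
rewrite /invmx Fu Au => i k; rewrite !mxE; apply: evalsM; first exact: evalsV.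
apply: evals_sign; apply: evals_det => i' k'; rewrite !mxE; exact: FA.
Qed.

End Evaluation.

(** * Boundedness outside the disk *)

Section Bounds.
Variable R : realType.
Implicit Types (f g : ratfun R).

Lemma horner_le_disk (C : numDomainType) (p : {poly C}) (z : C) :
  `|z| <= 1 -> `|p.[z]| <= \sum_(i < size p) `|p`_i|.
Proof.
move=> z1; rewrite horner_coef; apply: le_trans (ler_norm_sum _ _ _) _.
apply: ler_sum => i _; rewrite normrM normrX ler_piMr //.
by rewrite exprn_ile1.
Qed.

(** Over an algebraically closed field the bound is explicit: a factor X - a
    with |a| > 1 is at least |a| - 1 in modulus on the closed disk. *)
Lemma horner_ge_disk (C : numClosedFieldType) (p : {poly C}) :
  (forall z, `|z| <= 1 -> p.[z] != 0) ->
  exists2 c, 0 < c & forall z, `|z| <= 1 -> c <= `|p.[z]|.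
Proof.
have [r pE] := closed_field_poly_normal p; move=> pz.
have lp : lead_coef p != 0.
  by rewrite lead_coef_eq0; apply: contraNneq (pz 0 _) => [->|]; rewrite ?horner0 ?normr0.
have r1 a : a \in r -> 0 < `|a| - 1.
  move=> ar; rewrite subr_gt0 real_ltNge ?normr_real ?real1 //.
  apply/negP => /pz; rewrite pE hornerZ mulf_eq0 (negPf lp) /= horner_prod.
  by rewrite prodf_seq_neq0 => /allP /(_ _ ar) /=; rewrite !hornerE subrr eqxx.
exists (`|lead_coef p| * \prod_(a <- r) (`|a| - 1)).
  by rewrite mulr_gt0 ?normr_gt0 // big_seq prodr_gt0.
move=> z z1; rewrite [in leRHS]pE hornerZ normrM ler_wpM2l // horner_prod normr_prod.
rewrite big_seq [leRHS]big_seq; apply: ler_prod => a ar; rewrite ltW ?r1 //=.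
rewrite !hornerE distrC (le_trans _ (lerB_dist _ _)) //.
by rewrite lerD2l lerN2.
Qed.

Lemma reval_bounded_disk f : (forall z, `|z| <= 1 -> no_pole f z) ->
  exists M, forall z, `|z| <= 1 -> `|reval f z| <= M.
Proof.
move=> fz; have [|c c0 cq] := @horner_ge_disk _ (map_poly (real_complex R) (rden f)).
  by move=> z /fz; rewrite /no_pole rootE.
set p := map_poly (real_complex R) (rnum f).
exists ((\sum_(i < size p) `|p`_i|) / c) => z z1.
rewrite /reval normrM normfV ler_pM ?invr_ge0 ?horner_le_disk //.
by rewrite lef_pV2 ?posrE ?cq // (lt_le_trans c0) ?cq.
Qed.

(** The inversion z |-> 1/z carries the exterior of the disk, infinity included,
    to the closed disk. *)
Lemma reval_bounded_exterior f : (forall z, 1 <= `|z| -> no_pole f z) ->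
  no_pole (recip f) 0 -> exists M, forall z, 1 <= `|z| -> `|reval f z| <= M.
Proof.
move=> fz f0; have [|M fM] := @reval_bounded_disk (recip f).
  move=> z z1; have [->//|z0] := eqVneq z 0.
  suff /(evals_recip z0)[] : no_pole f z^-1 by [].
  by apply: fz; rewrite normfV invf_ge1 // normr_gt0.
exists M => z z1; have z0 : z != 0 by rewrite -normr_gt0 (lt_le_trans ltr01).
have zi0 : z^-1 != 0 by rewrite invr_eq0.
have [] := @evals_recip _ f z^-1 zi0; first by rewrite invrK fz.
by rewrite invrK => _ <-; apply: fM; rewrite normfV invf_le1 // (lt_le_trans ltr01).
Qed.

End Bounds.

(** * Singular values *)

Section SingularValues.
Variable R : realType.
Local Notation C := R[i].

Definition sqnorm n (x : 'cV[C]_n) : C := (x^t* *m x) 0 0.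

Lemma sqnormE n (x : 'cV[C]_n) : sqnorm x = \sum_i `|x i 0| ^+ 2.
Proof.
by rewrite /sqnorm mxE; apply: eq_bigr => i _; rewrite !mxE normCKC.
Qed.

Lemma sqnorm_ge0 n (x : 'cV[C]_n) : 0 <= sqnorm x.
Proof. by rewrite sqnormE sumr_ge0 // => i _; rewrite exprn_ge0. Qed.

Lemma sqnorm_gt0 n (x : 'cV[C]_n) : x != 0 -> 0 < sqnorm x.
Proof.
move=> x0; rewrite lt_def sqnorm_ge0 andbT; apply: contraNneq x0.
rewrite sqnormE => /eqP; rewrite psumr_eq0 => [/allP x0|i _]; last first.
  by rewrite exprn_ge0.
apply/eqP/colP => i; rewrite mxE; apply/eqP.
by have := x0 i; rewrite mem_index_enum sqrf_eq0 normr_eq0 => /(_ isT).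
Qed.

Lemma trmxC_mul m n p (A : 'M[C]_(m, n)) (B : 'M[C]_(n, p)) :
  (A *m B)^t* = B^t* *m A^t*.
Proof. by rewrite trmx_mul map_mxM. Qed.

Lemma sqnorm_mul m n (A : 'M[C]_(m, n)) x :
  sqnorm (A *m x) = (x^t* *m (A^t* *m A) *m x) 0 0.
Proof. by rewrite /sqnorm trmxC_mul !mulmxA. Qed.

(** The spectral theorem for the Gram matrix of A; the eigenvalues are
    nonnegative because diag d is itself the Gram matrix of A P^*. *)
Lemma spectral_gram m n (A : 'M[C]_(m, n)) : exists (P : 'M[C]_n) (d : 'rV[C]_n),
  [/\ P \is unitarymx, A^t* *m A = P^t* *m diag_mx d *m P & forall i, 0 <= d 0 i].
Proof.
set H := A^t* *m A.
have Hh : H \is normalmx.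
  by apply/normalmxP; rewrite /H trmxC_mul trmxCK.
have /orthomx_spectralP := Hh.
set P := spectralmx H; set d := spectral_diag H => HE.
have Pu : P \is unitarymx := spectral_unitarymx _.
rewrite invmx_unitary // in HE; exists P, d; split=> // i.
have dE : diag_mx d = (A *m P^t*)^t* *m (A *m P^t*).
  rewrite trmxC_mul trmxCK -mulmxA (mulmxA (A^t*)) -/H HE !mulmxA.
  by rewrite (unitarymxP Pu) mul1mx -mulmxA (unitarymxP Pu) mulmx1.
have := congr1 (fun X : 'M[C]_n => X i i) dE.
rewrite mxE eqxx mulr1n => ->; rewrite mxE sumr_ge0 // => k _.
by rewrite !mxE -normCKC exprn_ge0.
Qed.

(** Sum the moduli of the entries of v H = a v; since only an upper bound that
    is uniform in z is wanted, the crude sum of all entries suffices. *)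
Lemma eigenvalue_norm_le n (H : 'M[C]_n) a : eigenvalue H a ->
  `|a| <= \sum_i \sum_k `|H i k|.
Proof.
move=> /eigenvalueP[v vH v0].
have S0 : 0 < \sum_i `|v 0 i|.
  rewrite lt_def sumr_ge0 // andbT; apply: contraNneq v0 => /eqP.
  rewrite psumr_eq0 // => /allP v0; apply/eqP/rowP => i; rewrite mxE; apply/eqP.
  by have := v0 i; rewrite mem_index_enum normr_eq0 => /(_ isT).
rewrite -(ler_pM2r S0) mulr_sumr mulr_sumr.
apply: (@le_trans _ _ (\sum_k \sum_i `|v 0 i| * `|H i k|)).
  apply: ler_sum => k _; rewrite -normrM.
  have -> : a * v 0 k = (v *m H) 0 k by rewrite vH !mxE.
  rewrite mxE; apply: le_trans (ler_norm_sum _ _ _) _.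
  by apply: ler_sum => i _; rewrite normrM.
rewrite exchange_big; apply: ler_sum => i _ /=; rewrite -mulr_sumr mulrC.
rewrite ler_wpM2r // [leRHS](bigD1 i) //= lerDl sumr_ge0 // => *; exact: sumr_ge0.
Qed.

(** s <= 1 + s^2 avoids a square root in the bound. *)
Lemma singular_value_le m n (A : 'M[C]_(m, n)) s (M : C) :
  (forall i k, `|A i k| <= M) -> singular_value A s ->
  s <= 1 + complex.Re (\sum_(i < n) \sum_(k < n) \sum_(l < m) M * M).
Proof.
move=> AM [s0 /eigenvalue_norm_le].
rewrite ger0_norm ?ler0c ?exprn_ge0 // => sH.
have {sH}: (s ^+ 2)%:C <= \sum_(i < n) \sum_(k < n) \sum_(l < m) M * M.
  apply: le_trans sH _; apply: ler_sum => i _; apply: ler_sum => k _.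
  rewrite mxE; apply: le_trans (ler_norm_sum _ _ _) _.
  apply: ler_sum => l _; rewrite normrM ler_pM //.
  by rewrite !mxE norm_conjC AM.
rewrite lecE => /andP[_] /= sH.
by apply: (@le_trans _ _ (1 + s ^+ 2)); [nra | rewrite lerD2l].
Qed.

Lemma sqnorm_unitary n (P : 'M[C]_n) x : P \is unitarymx -> sqnorm (P *m x) = sqnorm x.
Proof.
rewrite sqnorm_mul -trmxC_unitary => /unitarymxP.
by rewrite trmxCK => ->; rewrite mulmx1.
Qed.

Lemma singular_value_diag m n (A : 'M[C]_(m, n)) (P : 'M[C]_n) (d : 'rV[C]_n) i :
  P \is unitarymx -> A^t* *m A = P^t* *m diag_mx d *m P -> 0 <= d 0 i ->
  singular_value A (Num.sqrt (complex.Re (d 0 i))).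
Proof.
move=> Pu AE d0; split; first exact: sqrtr_ge0.
have dr : (complex.Re (d 0 i))%:C = d 0 i by rewrite RRe_real // ger0_real.
rewrite sqr_sqrtr -?ler0c ?dr //.
apply/eigenvalueP; exists (row i P).
  by rewrite -row_mul AE !mulmxA (unitarymxP Pu) mul1mx row_mul row_diag_mx
             -scalemxAl -rowE.
apply: contraTneq (unitarymx_unit Pu) => P0.
rewrite unitmxE unitfE negbK (expand_det_row _ i) big1 // => k _.
by have /rowP/(_ k) := P0; rewrite !mxE => ->; rewrite mul0r.
Qed.

Lemma has_ubound_singular_value m n (A : 'M[C]_(m, n)) :
  has_ubound (singular_value A).
Proof.
eexists => s; apply: (@singular_value_le _ _ _ _ (\sum_i \sum_k `|A i k|)).
move=> i k; rewrite (bigD1 i) //= (bigD1 k) //= -addrA lerDl addr_ge0 //.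
  exact: sumr_ge0.
by apply: sumr_ge0 => *; exact: sumr_ge0.
Qed.

(** In an orthonormal basis of eigenvectors of the Gram matrix, |A x|^2 is the
    sum of the d_i |x_i|^2, and each sqrt d_i is a singular value. *)
Lemma sqnorm_le_sigma_max m n (A : 'M[C]_(m, n)) s x : sigma_max A <= s ->
  sqnorm (A *m x) <= (s ^+ 2)%:C * sqnorm x.
Proof.
move=> As; have [P [d [Pu AE d0]]] := spectral_gram A.
rewrite sqnorm_mul AE -(sqnorm_unitary x Pu) sqnormE mulr_sumr.
rewrite !mulmxA -mulmxA -trmxC_mul mul_mx_diag mxE; apply: ler_sum => i _.
rewrite !mxE mulrAC -normCKC mulrC ler_wpM2r ?exprn_ge0 //.
have sv := singular_value_diag Pu AE (d0 i).
have : Num.sqrt (complex.Re (d 0 i)) <= s.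
  by apply: le_trans As; apply: ub_le_sup => //; exact: has_ubound_singular_value.
rewrite -[d 0 i]RRe_real ?ger0_real // lecR => ds.
have s0 : 0 <= s by apply: le_trans ds; exact: sqrtr_ge0.
rewrite -[leLHS]sqr_sqrtr -?ler0c ?RRe_real ?ger0_real //.
by rewrite lerXn2r ?nnegrE ?sqrtr_ge0.
Qed.

Lemma sigma_max_le m n (A : 'M[C]_(m, n)) (M : C) : (0 < n)%N ->
  (forall i k, `|A i k| <= M) ->
  sigma_max A <= 1 + complex.Re (\sum_(i < n) \sum_(k < n) \sum_(l < m) M * M).
Proof.
move=> n0 AM; apply: ge_sup; last by move=> s; exact: singular_value_le.
have [P [d [Pu AE d0]]] := spectral_gram A.
by eexists; apply: (singular_value_diag (i := Ordinal n0) Pu AE); exact: d0.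
Qed.

Lemma sqnorm_le_Hinfty n (G : 'M[ratfun R]_n) (M : C) z x : (0 < n)%N ->
  (forall z, 1 < `|z| -> forall i k, `|mx_reval G z i k| <= M) ->
  1 < `|z| ->
  sqnorm (mx_reval G z *m x) <= (Hinfty_norm G ^+ 2)%:C * sqnorm x.
Proof.
move=> n0 GM z1; apply: sqnorm_le_sigma_max; apply: ub_le_sup; last by exists z.
eexists => _ [w w1 <-]; apply: (sigma_max_le (M := M)) => // i k.
exact: GM.
Qed.

End SingularValues.

(** * Minimum-phase factors on the closed exterior *)

Section MinimumPhase.
Variable R : realType.
Local Notation C := R[i].
Implicit Types (z : C).

Lemma closure_unit_disk z : closure (@unit_disk R) z -> `|z| <= 1.
Proof.
move=> cz; rewrite real_leNgt ?normr_real ?real1 //; apply/negP => z1.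
have e0 : 0 < `|z| - 1 by rewrite subr_gt0.
have [w [w1 zw]] := cz _ (@nbhsx_ballx _ (C^o) z _ e0).
move: zw; rewrite -ball_normE /= => zw.
have : `|z - w + w| < (`|z| - 1) + 1.
  by rewrite (le_lt_trans (ler_normD _ _)) // ltrD.
by rewrite !subrK ltxx.
Qed.

Lemma min_phase_no_pole n (W : 'M[ratfun R]_n) : minimum_phase W ->
  (forall z, 1 <= `|z| -> forall i k, holo_at (W i k) z) /\
  (forall i k, no_pole (recip (W i k)) 0).
Proof.
case=> [[U [_ eU WU]] _ _]; split=> [z z1 i k|i k].
  apply: (WU (Some z)); apply: eU => -[w w1] [wz]; move: w1.
  by rewrite /unit_disk /= wz => /(le_lt_trans z1); rewrite ltxx.
have /WU /(_ i k) [] // : U None by apply: eU => -[].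
Qed.

Lemma min_phase_inv_no_pole n (W : 'M[ratfun R]_n) : minimum_phase W ->
  (forall z, 1 < `|z| -> forall i k, no_pole (invmx W i k) z) /\
  (forall i k, no_pole (recip (invmx W i k)) 0).
Proof.
case=> [_ _ WU]; split=> [z z1 i k|i k].
  have [] // : holo_at (invmx W i k) z.
  apply: (WU (Some z)) => -[w /closure_unit_disk w1] [wz]; move: w1.
  by rewrite wz => /(lt_le_trans z1); rewrite ltxx.
have [] // : holo_at (recip (invmx W i k)) 0.
by apply: (WU None) => -[].
Qed.

Lemma circle_inv z : `|z| = 1 -> z^-1 = z^*%C.
Proof. by move=> z1; rewrite invc_norm z1 expr1n invr1 mul1r. Qed.

(** On the circle 1/z is the conjugate of z, and real coefficients turn
    conjugation of the argument into conjugation of the value. *)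
Lemma mx_evals_para m n (W : 'M[ratfun R]_(m, n)) z : `|z| = 1 ->
  (forall i k, no_pole (W i k) z) ->
  mx_evals (para W) z ((mx_reval W z)^t*).
Proof.
move=> z1 Wz i k; rewrite !mxE.
have z0 : z != 0 by rewrite -normr_eq0 z1 oner_eq0.
have -> : Num.conj (reval (W k i) z) = reval (W k i) z^-1.
  by rewrite circle_inv // reval_conj.
by apply: evals_recip => //; rewrite circle_inv // no_pole_conj.
Qed.

Lemma factor_on_circle n (W : 'M[ratfun R]_n) Phi (z : circle R) :
  spectral_factor W Phi -> (forall i k, no_pole (W i k) (sval z)) ->
  Phi z = mx_reval W (sval z) *m (mx_reval W (sval z))^t*.
Proof.
move=> WPhi Wz; have [_ ->] := WPhi z.
have We : mx_evals W (sval z) (mx_reval W (sval z)) by apply/mx_evalsP.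
by have /mx_evalsP[_ ->] := mx_evalsM We (mx_evals_para (eqP (svalP z)) Wz).
Qed.

Lemma posdef_form n (A : 'M[C]_n) (x : 'cV[C]_n) :
  (x^t* *m (A *m A^t*) *m x) 0 0 = sqnorm (A^t* *m x).
Proof. by rewrite sqnorm_mul trmxCK. Qed.

Lemma posdef_unitmx n (A : 'M[C]_n) : posdefmx (A *m A^t*) -> A \in unitmx.
Proof.
case=> _ pd; rewrite -row_free_unit -kermx_eq0; apply/negPn/negP.
move=> /rowV0Pn[v /sub_kermxP vA v0].
have /pd : v^t* != 0.
  by apply: contraNneq v0 => /(congr1 (fun X => X^t*)); rewrite trmxCK => ->;
     rewrite trmx0 map_mx0.
rewrite posdef_form /sqnorm -trmxC_mul vA.
by rewrite trmx0 map_mx0 mulmx0 mxE ltxx.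
Qed.

(** Outside the closed disk the inverse is analytic, hence evaluates to an
    inverse; on the circle invertibility comes from W W^* = Phi > 0. *)
Lemma min_phase_unit n (W : 'M[ratfun R]_n) Phi z : min_phase_factor W Phi ->
  (forall w, posdefmx (Phi w)) -> 1 <= `|z| ->
  mx_reval W z \in unitmx.
Proof.
move=> [WPhi mW] pd z1; have [Wz _] := min_phase_no_pole mW.
have We : mx_evals W z (mx_reval W z).
  by apply/mx_evalsP; split=> // i k; have [] := Wz z z1 i k.
have [z1'|z1'] := eqVneq `|z| 1.
  apply: posdef_unitmx.
  rewrite -(@factor_on_circle n W Phi (exist _ z (introT eqP z1'))) //.
  by move=> i k; have [] := Wz z z1 i k.
have {}z1 : 1 < `|z| by rewrite lt_def z1'.
have [iWz _] := min_phase_inv_no_pole mW.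
have iWe : mx_evals (invmx W) z (mx_reval (invmx W) z) by apply/mx_evalsP; split=> //; exact: iWz.
have [_ Wu _] := mW.
have /mx_evalsP[_] := mx_evalsM We iWe; rewrite mulmxV // => /esym.
have -> : mx_reval (1%:M : 'M[ratfun R]_n) z = 1%:M.
  apply/matrixP => i k; rewrite !mxE.
  by case: eqP => _; [have [_ ->] := evals1 z | have [_ ->] := evals0 z].
by case/mulmx1_unit.
Qed.

End MinimumPhase.

(** * Adjoints and limits at the circle *)

Section Comparison.
Variable R : realType.
Local Notation C := R[i].
Implicit Types (z : C).

Lemma mx_bounded m n (F : 'M[ratfun R]_(m, n)) :
  (forall z, 1 <= `|z| -> forall i k, no_pole (F i k) z) ->
  (forall i k, no_pole (recip (F i k)) 0) ->
  exists M, forall z, 1 <= `|z| -> forall i k, `|mx_reval F z i k| <= M.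
Proof.
move=> Fz F0.
have /choice[M FM] (p : 'I_m * 'I_n) :
    exists M, forall z, 1 <= `|z| -> `|reval (F p.1 p.2) z| <= M.
  by apply: reval_bounded_exterior => // z z1; exact: Fz.
exists (\sum_p `|M p|) => z z1 i k; rewrite mxE.
have FMz : `|reval (F i k) z| <= M (i, k) by exact: (FM (i, k)).
rewrite (le_trans FMz) // (bigD1 (i, k)) //=.
by rewrite ger0_norm ?(le_trans _ FMz) // lerDl sumr_ge0.
Qed.

Lemma mx_bounded_mul m n p (A : 'M[C]_(m, n)) (B : 'M[C]_(n, p)) M N :
  (forall i k, `|A i k| <= M) -> (forall i k, `|B i k| <= N) ->
  forall i k, `|(A *m B) i k| <= \sum_(j < n) M * N.
Proof.
move=> AM BN i k; rewrite mxE; apply: le_trans (ler_norm_sum _ _ _) _.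
by apply: ler_sum => j _; rewrite normrM ler_pM.
Qed.

(** Expand 0 <= |b y - G G^* y|^2, and bound |G G^* y|^2 by b |G^* y|^2. *)
Lemma sqnorm_adjoint_le n (G : 'M[C]_n) (b : C) : 0 < b ->
  (forall x, sqnorm (G *m x) <= b * sqnorm x) ->
  forall y, sqnorm (G^t* *m y) <= b * sqnorm y.
Proof.
move=> b0 Gb y; set w := G^t* *m y.
have bc : Num.conj b = b by apply/CrealP; rewrite ger0_real // ltW.
have := sqnorm_ge0 (b *: y - G *m w).
have -> : sqnorm (b *: y - G *m w) =
    b ^+ 2 * sqnorm y - b * sqnorm w *+ 2 + sqnorm (G *m w).
  have yw : y^t* *m (G *m w) = w^t* *m w by rewrite /w trmxC_mul trmxCK !mulmxA.
  have wy : (G *m w)^t* *m y = w^t* *m w by rewrite trmxC_mul -mulmxA.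
  have tE (u v : 'cV[C]_n) : (b *: u - v)^t* = b *: u^t* - v^t*.
    by apply/matrixP => i k; rewrite !mxE rmorphB rmorphM; congr (_ * _ - _); exact: bc.
  rewrite /sqnorm tE.
  rewrite mulmxBl !mulmxBr -!scalemxAl -!scalemxAr yw wy.
  by rewrite !mxE; ring.
move=> H; rewrite -subr_ge0 -(pmulr_rge0 _ b0).
apply: le_trans H _; rewrite -subr_ge0.
have := Gb w; rewrite -subr_ge0; congr (0 <= _); ring.
Qed.

(** Conjugating inside the moduli leaves an expression in the entries of A
    itself, whose continuity is inherited from that of the entries. *)
Lemma sqnorm_adjE n (A : 'M[C]_n) x :
  sqnorm (A^t* *m x) = \sum_i `|\sum_k A k i * Num.conj (x k 0)| ^+ 2.
Proof.
rewrite sqnormE; apply: eq_bigr => i _; rewrite -norm_conjC mxE rmorph_sum.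
by congr (`|_| ^+ 2); apply: eq_bigr => k _; rewrite rmorphM !mxE; congr (_ * _); exact: conjCK.
Qed.

Lemma holo_continuous f z : holo_at f z ->
  (reval f : C^o -> C^o) w @[w --> (z : C^o)] --> (reval f z : C^o).
Proof. by case=> _ /derivable1_diffP /differentiable_continuous. Qed.

Lemma sqnorm_adj_cvg n (T : Type) (F : set_system T) (A : T -> 'M[C]_n) (B : 'M[C]_n) x :
  forall FF : Filter F, (forall i k, (A w i k : C^o) @[w --> F] --> (B i k : C^o)) ->
  (sqnorm ((A w)^t* *m x) : C^o) @[w --> F] --> (sqnorm (B^t* *m x) : C^o).
Proof.
move=> FF AB; rewrite sqnorm_adjE (funext (fun w => sqnorm_adjE (A w) x)).
apply: cvg_big => [|i _]; first exact: add_continuous.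
have norm_cvg : `|\sum_k A w k i * Num.conj (x k 0) : C^o| @[w --> F] -->
    (`|\sum_k B k i * Num.conj (x k 0)| : C^o).
  apply: (@cvg_norm _ C^o); apply: cvg_big => [|k _]; first exact: add_continuous.
  by apply: cvgMr_tmp; exact: AB.
by rewrite expr2; apply: cvgM.
Qed.

Lemma sqnorm_adj_continuous n (W : 'M[ratfun R]_n) z x :
  (forall i k, holo_at (W i k) z) ->
  (sqnorm ((mx_reval W w)^t* *m x) : C^o) @[w --> (z : C^o)] -->
  (sqnorm ((mx_reval W z)^t* *m x) : C^o).
Proof.
move=> Wz; apply: (@sqnorm_adj_cvg _ _ _ (mx_reval W) _ x (nbhs_filter (z : C^o))) => i k.
rewrite mxE.
rewrite (_ : (fun w => _) = reval (W i k)); first exact: holo_continuous.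
by apply/funext => w; rewrite mxE.
Qed.

(** The order of the complex numbers is partial, so <= passes to the limit only
    because F z and G z are real: if G z < F z, continuity gives G < F at a point
    z (1 + e / 2) of the radius through z. *)
Lemma radial_limit_le (F G : C -> C) z : `|z| = 1 ->
  (F w : C^o) @[w --> (z : C^o)] --> (F z : C^o) ->
  (G w : C^o) @[w --> (z : C^o)] --> (G z : C^o) ->
  F z \is Num.real -> G z \is Num.real ->
  (forall w, 1 < `|w| -> F w <= G w) -> F z <= G z.
Proof.
move=> z1 Fc Gc Fr Gr FG; rewrite real_leNgt //; apply/negP => GF.
have e0 : 0 < F z - G z by rewrite subr_gt0.
have NF := nbhs_filter (z : C^o).
have FGc := @cvgB _ C^o _ _ NF _ _ _ _ Fc Gc.
have /nbhs_ballP[e /= e_gt0 He] := (@cvgrPdist_lt _ C^o _ _ NF _ _).1 FGc _ e0.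
have eE : `|1 + e / 2| = 1 + e / 2 by rewrite ger0_norm // addr_ge0 // divr_ge0 // ltW.
have /He : ball (z : C^o) e (z * (1 + e / 2)).
  rewrite -ball_normE /= distrC mulrDr mulr1 addrAC subrr add0r normrM z1 mul1r.
  by rewrite gtr0_norm ?divr_gt0 // ltr_pdivrMr // mulr_natr mulr2n ltrDl.
have w1 : 1 < `|z * (1 + e / 2)|.
  by rewrite normrM z1 mul1r eE ltrDl divr_gt0.
have /= := FG _ w1; rewrite -subr_le0 => D0 /=.
rewrite -[_ (_ * _)]/(F (z * (1 + e / 2)) - G (z * (1 + e / 2))).
move: (F _ - G _) D0 (F z - G z) e0 => d d0 a a0.
have ad : a <= a - d by rewrite lerDl oppr_ge0.
rewrite ger0_norm ?(le_trans (ltW a0)) // => /(le_lt_trans ad).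
by rewrite ltxx.
Qed.

End Comparison.

(** * Comparison of the two densities *)

Section Interpolation.
Variable R : realType.
Local Notation C := R[i].

Lemma const1_neq0 n : (0 < n)%N -> const_mx 1 != 0 :> 'cV[C]_n.
Proof.
move=> n_gt0; apply/eqP => /colP/(_ (Ordinal n_gt0)); rewrite !mxE => /eqP.
by rewrite oner_eq0.
Qed.

Section TwoFactors.
Variables (n : nat) (n_gt0 : (0 < n)%N).
Variables (Phi1 Phi2 : circle R -> 'M[C]_n) (W1 W2 : 'M[ratfun R]_n).
Hypotheses (pd1 : forall z, posdefmx (Phi1 z)) (pd2 : forall z, posdefmx (Phi2 z)).
Hypotheses (hW1 : min_phase_factor W1 Phi1) (hW2 : min_phase_factor W2 Phi2).

Let G := invmx W1 *m W2.
Let b := Hinfty_norm G ^+ 2.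

Lemma ratio_evals z : 1 <= `|z| ->
  mx_evals G z (invmx (mx_reval W1 z) *m mx_reval W2 z).
Proof.
move=> z1; have holo1 := (min_phase_no_pole (proj2 hW1)).1 z z1.
have holo2 := (min_phase_no_pole (proj2 hW2)).1 z z1.
apply: mx_evalsM; last by apply/mx_evalsP; split=> // i k; have [] := holo2 i k.
apply: mx_evals_inv; last exact: min_phase_unit hW1 pd1 z1.
by apply/mx_evalsP; split=> // i k; have [] := holo1 i k.
Qed.

(** Each factor W1^-1, W2 is bounded separately: behaviour at infinity is read
    off the entries of the factors, not off those of the product. *)
Lemma ratio_bounded : exists M, forall z, 1 <= `|z| ->
  forall i k, `|mx_reval G z i k| <= M.
Proof.
have [holo2 rec2] := min_phase_no_pole (proj2 hW2).
have [holo1 _] := min_phase_no_pole (proj2 hW1).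
have [_ irec1] := min_phase_inv_no_pole (proj2 hW1).
have We1 z (z1 : 1 <= `|z|) : mx_evals (invmx W1) z (invmx (mx_reval W1 z)).
  apply: mx_evals_inv; last exact: min_phase_unit hW1 pd1 z1.
  by apply/mx_evalsP; split=> // i k; have [] := holo1 z z1 i k.
have [z z1 i k|//|M1 WM1] := @mx_bounded _ _ _ (invmx W1).
  by have [] := We1 z z1 i k.
have [z z1 i k|//|M2 WM2] := @mx_bounded _ _ _ W2.
  by have [] := holo2 z z1 i k.
exists (\sum_(j < n) M1 * M2) => z z1.
have /mx_evalsP[_ ->] := ratio_evals z1.
have /mx_evalsP[_ <-] := We1 z z1.
by apply: mx_bounded_mul; [exact: WM1 | exact: WM2].
Qed.

Lemma ratio_le z x : 1 < `|z| ->
  sqnorm (mx_reval G z *m x) <= b%:C * sqnorm x.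
Proof.
move=> z1; have [M GM] := ratio_bounded.
by apply: (sqnorm_le_Hinfty (M := M)) => // w w1; apply: GM; exact: ltW.
Qed.

(** If the norm vanished, so would the invertible matrix G(2). *)
Lemma Hinfty_gt0 : 0 < b.
Proof.
have two1 : 1 < `|2 : C| by rewrite normr_nat ltr1n.
have x0 := const1_neq0 n_gt0; set x := const_mx 1 in x0.
rewrite lt_def exprn_even_ge0 // andbT; apply/eqP => b0.
have := ratio_le x two1; rewrite b0 rmorph0 mul0r.
apply/negP; rewrite lt_geF // sqnorm_gt0 //.
have /mx_evalsP[_ ->] := ratio_evals (ltW two1).
have u1 := min_phase_unit hW1 pd1 (ltW two1).
have u2 := min_phase_unit hW2 pd2 (ltW two1).
have Gu : invmx (mx_reval W1 2) *m mx_reval W2 2 \in unitmx.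
  by rewrite unitmx_mul unitmx_inv u1.
by apply: contraNneq x0 => Gx; rewrite -(mulKmx Gu x) Gx mulmx0.
Qed.

(** Where |z| > 1, the bound on the adjoint of G and W2 = W1 G compare W2 W2^*
    with b W1 W1^*; the factors W1 and W2 are continuous at the circle, so the
    comparison survives there, where these products are the densities. *)
Lemma density_le (z : circle R) (x : 'cV[C]_n) :
  (x^t* *m Phi2 z *m x) 0 0 <= b%:C * (x^t* *m Phi1 z *m x) 0 0.
Proof.
have z1 : `|sval z| = 1 := eqP (svalP z).
have z1' : 1 <= `|sval z| by rewrite z1.
have [holo1 _] := min_phase_no_pole (proj2 hW1).
have [holo2 _] := min_phase_no_pole (proj2 hW2).
rewrite (factor_on_circle (proj1 hW1)); last by move=> i k; have [] := holo1 _ z1' i k.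
rewrite (factor_on_circle (proj1 hW2)); last by move=> i k; have [] := holo2 _ z1' i k.
rewrite !posdef_form.
apply: (@radial_limit_le R
  (fun w => sqnorm ((mx_reval W2 w)^t* *m x))
  (fun w => b%:C * sqnorm ((mx_reval W1 w)^t* *m x))) => //.
- by apply: sqnorm_adj_continuous; exact: holo2.
- apply: (@cvgMl_tmp _ _ _ (nbhs_filter (sval z : C^o))).
  by apply: sqnorm_adj_continuous; exact: holo1.
- by rewrite ger0_real ?sqnorm_ge0.
- by rewrite ger0_real // mulr_ge0 ?sqnorm_ge0 // ler0c ltW ?Hinfty_gt0.
move=> w w1.
have /mx_evalsP[_ GE] := ratio_evals (ltW w1).
have u1 := min_phase_unit hW1 pd1 (ltW w1).
have -> : mx_reval W2 w = mx_reval W1 w *m mx_reval G w by rewrite GE mulKVmx.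
rewrite trmxC_mul -mulmxA; apply: sqnorm_adjoint_le.
  by rewrite ltcR Hinfty_gt0.
by move=> y; exact: ratio_le.
Qed.

End TwoFactors.

(** Everything but positivity is stable under real linear combinations, and the
    nonnegativity of <f, Phi f> follows from that of its integrand. *)
Lemma combination_rat_density n (Phi1 Phi2 : circle R -> 'M[C]_n) (c1 c2 : R) :
  rat_spectral_density Phi1 -> rat_spectral_density Phi2 ->
  (forall z, posdefmx (c2%:C *: Phi2 z + c1%:C *: Phi1 z)) ->
  pd_rat_spectral_density (fun z => c2%:C *: Phi2 z + c1%:C *: Phi1 z).
Proof.
move=> [[[M1 b1] m1 h1 _] [F1 r1]] [[[M2 b2] m2 h2 _] [F2 r2]] pd.
split=> //; split; last first.
  exists (map_mx (fun f => tofrac c2%:P * f) F2 + map_mx (fun f => tofrac c1%:P * f) F1).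
  move=> z; have [p1 ->] := r1 z; have [p2 ->] := r2 z.
  suff /mx_evalsP[? <-] : mx_evals
    (map_mx (fun f => tofrac c2%:P * f) F2 + map_mx (fun f => tofrac c1%:P * f) F1)
    (sval z) (c2%:C *: mx_reval F2 (sval z) + c1%:C *: mx_reval F1 (sval z)) by [].
  by move=> i k; rewrite !mxE; apply: evalsD; apply: evalsM; try exact: evalsC; split.
split.
- exists (`|c2| * M2 + `|c1| * M1) => z i k; rewrite !mxE.
  apply: le_trans (ler_normD _ _) _; rewrite !normrM rmorphD !rmorphM /=.
  have nC (c : R) : `|c%:C| = `|c|%:C by rewrite normc_def /= expr0n addr0 sqrtr_sqr.
  by rewrite !nC lerD // ler_wpM2l ?ler0c.
- move=> i k; have [mr1 mi1] := m1 i k; have [mr2 mi2] := m2 i k.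
  split.
    rewrite (_ : (fun _ => _) = (fun t => c2 * complex.Re (Phi2 (cis t) i k) +
       c1 * complex.Re (Phi1 (cis t) i k))); last first.
      apply/funext => t; rewrite !mxE.
      by case: (Phi1 _ _ _) (Phi2 _ _ _) => [? ?] [? ?] /=; ring.
    by apply: measurable_funD; apply: measurable_funM.
  rewrite (_ : (fun _ => _) = (fun t => c2 * complex.Im (Phi2 (cis t) i k) +
       c1 * complex.Im (Phi1 (cis t) i k))); last first.
    apply/funext => t; rewrite !mxE.
    by case: (Phi1 _ _ _) (Phi2 _ _ _) => [? ?] [? ?] /=; ring.
  by apply: measurable_funD; apply: measurable_funM.
- by move=> z; have [] := pd z.
move=> f _; have q0 t : 0 <= (((f (cis t))^t* *m
   ((c2%:C *: Phi2 (cis t) + c1%:C *: Phi1 (cis t)) *m f (cis t))) 0 0).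
  have [_ {}pd] := pd (cis t); have [->|/pd/ltW] := eqVneq (f (cis t)) 0.
    by rewrite !mulmx0 mxE.
  by rewrite mulmxA.
rewrite /inner /circle_integral lecE /=; apply/andP; split.
  rewrite [X in X / _](_ : _ = 0) ?mul0r //.
  rewrite (@eq_Rintegral _ _ _ _ _ (fun=> 0)) => [|t _].
    by rewrite /Rintegral integral0.
  by have := q0 t; rewrite lecE => /andP[/eqP].
rewrite divr_ge0 ?mulr_ge0 ?pi_ge0 //; apply: Rintegral_ge0 => t _.
by have := q0 t; rewrite lecE => /andP[].
Qed.

End Interpolation.

(** * Positivity of the interpolant *)

(** With 0 < p, q, the value is p (v - a u) + q (b u - v) over b - a; the two
    nonnegative differences add up to (b - a) u, so they do not both vanish. *)
Lemma interpolation_gt0 (R : realType) (a b p q u v : R) : a < b ->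
  0 < p -> 0 < q -> 0 < u -> a * u <= v -> v <= b * u ->
  0 < (p - q) / (b - a) * v + (b * q - a * p) / (b - a) * u.
Proof.
move=> ab p0 q0 u0 auv vbu.
have ba : 0 < b - a by rewrite subr_gt0.
rewrite (_ : _ + _ = (p * (v - a * u) + q * (b * u - v)) / (b - a)); last first.
  by field; rewrite gt_eqF.
rewrite divr_gt0 //; have [vau|] := eqVneq v (a * u); last first.
  move=> ne; rewrite ltr_pwDl ?mulr_gt0 ?mulr_ge0 ?subr_ge0 ?subr_gt0 ?(ltW q0) //.
  by rewrite lt_def ne.
by rewrite vau subrr mulr0 add0r -mulrBl !mulr_gt0.
Qed.

Lemma posdef_combination (R : realType) n (A B : 'M[R[i]]_n) (c2 c1 : R) :
  posdefmx A -> posdefmx B ->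
  (forall (x : 'cV[R[i]]_n) u v, x != 0 -> (x^t* *m A *m x) 0 0 = u%:C ->
     (x^t* *m B *m x) 0 0 = v%:C -> 0 < u -> 0 < c2 * v + c1 * u) ->
  posdefmx (c2%:C *: B + c1%:C *: A).
Proof.
move=> [Ah Ap] [Bh Bp] H; split.
  apply/matrixP => i k; rewrite [in LHS]Ah [in LHS]Bh !mxE rmorphD !rmorphM.
  by congr (_ * _ + _ * _); apply/esym; exact: conjc_real.
move=> x x0; rewrite mulmxDr mulmxDl -!scalemxAr -!scalemxAl !mxE.
have rA := RRe_real (gtr0_real (Ap x x0)).
have rB := RRe_real (gtr0_real (Bp x x0)).
have uA : 0 < complex.Re ((x^t* *m A *m x) 0 0) by rewrite -ltcR rA Ap.
have := H x _ _ x0 (esym rA) (esym rB) uA.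
by rewrite -ltcR rmorphD !rmorphM /= rA rB !mxE.
Qed.

Theorem proposition1 (R : realType) (n : nat) (hn : (0 < n)%N)
    (Phi1 Phi2 : circle R -> 'M[R[i]]_n)
    (W1 W2 : 'M[ratfun R]_n) (tau : R)
    (hPhi1 : pd_rat_spectral_density Phi1)
    (hPhi2 : pd_rat_spectral_density Phi2)
    (hW1 : min_phase_factor W1 Phi1)
    (hW2 : min_phase_factor W2 Phi2) :
  pd_rat_spectral_density
    (chi_T Phi1 Phi2 (alpha W1 W2) (beta W1 W2) tau).
Proof.
have [rat1 pd1] := hPhi1; have [rat2 pd2] := hPhi2.
set a := alpha W1 W2; set b := beta W1 W2.
have b0 : 0 < b := Hinfty_gt0 hn pd1 pd2 hW1 hW2.
have b'0 := Hinfty_gt0 hn pd2 pd1 hW2 hW1.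
have a0 : 0 < a by rewrite /a /alpha mul1r invr_gt0.
have upper z (x : 'cV_n) u v : (x^t* *m Phi1 z *m x) 0 0 = u%:C ->
    (x^t* *m Phi2 z *m x) 0 0 = v%:C -> v <= b * u.
  have := density_le hn pd1 pd2 hW1 hW2 z x => + q1 q2.
  by rewrite q1 q2 -rmorphM /= lecR.
have lower z (x : 'cV_n) u v : (x^t* *m Phi1 z *m x) 0 0 = u%:C ->
    (x^t* *m Phi2 z *m x) 0 0 = v%:C -> a * u <= v.
  have := density_le hn pd2 pd1 hW2 hW1 z x => + q1 q2.
  by rewrite q1 q2 -rmorphM /= lecR /a /alpha mul1r ler_pdivrMl.
(* Both bounds at one point of the circle compare a u with b u for some u > 0. *)
have ab : a <= b.
  have x0 := const1_neq0 R hn; set x := const_mx 1 in x0.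
  have p1 := (pd1 (cis 0)).2 x x0; have p2 := (pd2 (cis 0)).2 x x0.
  have r1 := esym (RRe_real (gtr0_real p1)).
  have r2 := esym (RRe_real (gtr0_real p2)).
  rewrite r1 ltcR in p1.
  by rewrite -(ler_pM2r p1) (le_trans (lower _ _ _ _ r1 r2)) // (upper _ _ _ _ r1 r2).
rewrite /chi_T; case: eqP => /= [<-|/eqP ba].
  rewrite (_ : (fun _ => _) =
    (fun z => (0 : R)%:C *: Phi2 z + (b `^ tau)%:C *: Phi1 z)); last first.
    by apply/funext => z; rewrite rmorph0 scale0r add0r.
  apply: combination_rat_density => // z; apply: posdef_combination => // x u v.
  by move=> _ _ _ u0; rewrite mul0r add0r mulr_gt0 // powR_gt0.
have {}ab : a < b by rewrite lt_def ba.
apply: combination_rat_density => // z; apply: posdef_combination => // x u v.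
move=> _ q1 q2 u0; apply: interpolation_gt0 => //; rewrite ?powR_gt0 //.
  exact: lower q1 q2.
exact: upper q1 q2.
Qed.
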